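(* For $R=\mathbb{Z}_{25}$ and for $R=\mathbb{S}_5=\mathbb{F}_5[X]/(X^2)$ there exist projective arcs with parameters $(355,15)$, $(375,16)$ and $(395,17)$ in $\mathrm{PHG}(2,R)$.
   Context: For a finite chain ring $R$ of length $2$ with residue field $\mathbb{F}_q$, the projective Hjelmslev plane $\mathrm{PHG}(2,R)$ is the incidence structure whose points are the free rank-$1$ submodules of the right module $R_R^3$, whose lines are the free rank-$2$ submodules of $R_R^3$, with incidence given by inclusion. A projective $(k,n)$-arc is a set of $k$ points meeting every line in at most $n$ points. *)

(* Defs.v *)
From HB Require Import structures.
From mathcomp Require Import all_boot all_order all_algebra.
From mathcomp Require Import ring.
Set Implicit Arguments. Unset Strict Implicit. Unset Printing Implicit Defensive.
Import GRing.Theory.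
Local Open Scope ring_scope.

(* The ring S_5 = F_5[X]/(X^2), realised as pairs (a,b) <-> a + b X    *)
(* with (a,b)(c,d) = (ac, ad + bc).                                    *)
Definition S5 : Type := ('F_5 * 'F_5)%type.
HB.instance Definition _ := Finite.on S5.
HB.instance Definition _ := GRing.Zmodule.on S5.

Definition S5_one : S5 := (1, 0).
Definition S5_mul (x y : S5) : S5 := (x.1 * y.1, x.1 * y.2 + x.2 * y.1).
Definition S5_X : S5 := (0, 1).

Lemma S5_mulA : associative S5_mul.
Proof. by move=> [a b] [c d] [e f]; rewrite /S5_mul /=; congr pair; ring. Qed.
Lemma S5_mulC : commutative S5_mul.
Proof. by move=> [a b] [c d]; rewrite /S5_mul /=; congr pair; ring. Qed.
Lemma S5_mul1 : left_id S5_one S5_mul.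
Proof. by move=> [a b]; rewrite /S5_mul /= !mul1r mul0r addr0. Qed.
Lemma S5_mulDl : left_distributive S5_mul +%R.
Proof. by move=> [a b] [c d] [e f]; rewrite /S5_mul /=; congr pair; rewrite /=; ring. Qed.
Lemma S5_one_neq0 : S5_one != 0.
Proof. by []. Qed.

HB.instance Definition _ := GRing.Zmodule_isComNzRing.Build S5
  S5_mulA S5_mulC S5_mul1 S5_mulDl S5_one_neq0.

(* The projective Hjelmslev plane PHG(2,R) for a finite commutative   *)
(* ring R (for commutative R the right module R_R^3 is R^3 with       *)
(* scalar multiplication, written a *: x).                            *)
Section PHG.
Variable R : finComNzRingType.

(* a free rank-1 submodule of R^3: the image of an injective linear    *)
(* map R -> R^3, i.e. a |-> a *: x with this map injective             *)
Definition is_point (S : {set 'rV[R]_3}) : Prop :=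
  exists x : 'rV[R]_3,
    S = [set a *: x | a : R] /\ injective (fun a : R => a *: x).

(* a free rank-2 submodule of R^3: the image of an injective linear    *)
(* map R^2 -> R^3, i.e. (a,b) |-> a *: x + b *: y with this injective   *)
Definition is_line (S : {set 'rV[R]_3}) : Prop :=
  exists x y : 'rV[R]_3,
    S = [set ab.1 *: x + ab.2 *: y | ab : R * R] /\
    injective (fun ab : R * R => ab.1 *: x + ab.2 *: y).

Definition is_proj_arc (K : {set {set 'rV[R]_3}}) (k n : nat) : Prop :=
  [/\ (forall P, P \in K -> is_point P),
      #|K| = k &
      forall L, is_line L -> (#|[set P in K | P \subset L]| <= n)%N].

Definition proj_arc_exists (k n : nat) : Prop :=
  exists K : {set {set 'rV[R]_3}}, is_proj_arc K k n.
End PHG.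

(* Main.v *)
(** Both rings are of the form R = {a + b pi : 0 <= a, b < 5} with pi^2 = 0 and
    5 = kappa pi, where kappa = 1 for Z_25 (pi = 5) and kappa = 0 for S_5 (pi = X).
    Reduction modulo pi maps the Hjelmslev plane onto PG(2,5); the 25 points over a
    point x of PG(2,5) form an affine plane AG(2,5) in which the lines over a line
    l of PG(2,5) through x cut out one parallel class of line segments.

    The arcs are unions of such segments: over each x one takes a set C_x of
    segments from the parallel class of a single line d(x) through x.  A line over
    l then meets the part over x in l in |C_x| points if d(x) <> l, and in 0 or 5
    points if d(x) = l.  So the intersection numbers over l depend only on the sizes
    |C_x| and on a configuration of at most six parallel classes of an affine plane
    of order 5, not on the ring, and the same data (d(x), C_x) serve both rings.
    The data were found by a computer search; the total sizes and the intersection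
    numbers with all 775 lines are verified by evaluation. *)

Require Import Defs.
From mathcomp Require Import all_boot all_order all_algebra.
From mathcomp Require Import ring zify.
Set Implicit Arguments. Unset Strict Implicit. Unset Printing Implicit Defensive.
Import GRing.Theory.

(** * Digit vectors and the numerical checks *)

Definition dot (u v : seq nat) : nat :=
  nth 0 u 0 * nth 0 v 0 + nth 0 u 1 * nth 0 v 1 + nth 0 u 2 * nth 0 v 2.

Definition digit_vectors : seq (seq nat) :=
  [seq a :: v | a <- iota 0 5, v <- [seq [:: b; c] | b <- iota 0 5, c <- iota 0 5]].

Definition pivot (u : seq nat) : nat := find (predC1 0) u.

(** Picks one representative u + pi v modulo unit scalars. For u = 0 the pivot is past the end and
    the default 0 fails the first test. *)
Definition normal_digits (u v : seq nat) : bool :=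
  (nth 0 u (pivot u) == 1) && (nth 0 v (pivot u) == 0).

(* (x, d, cs): the points p over x with <d, p> = pi c for some c in cs. *)
Definition segments : Type := (seq nat * seq nat * seq nat)%type.

(* (x, y) stands for the vector x + pi y.  The carry kappa * (dot d x %/ 5) is the
   contribution of <d, x> to the pi-digit of <d, x + pi y>. *)
Definition segment_points (kappa : nat) (s : segments) :=
  let: (x, d, cs) := s in
  [seq (x, y) | y <- digit_vectors &
    normal_digits x y && ((kappa * (dot d x %/ 5) + dot d y) %% 5 \in cs)].

Definition arc_points (kappa : nat) (ss : seq segments) :=
  flatten (map (segment_points kappa) ss).

(* [normal_digits h0 h1] selects one equation h0 + pi h1 for each line. *)
Definition line_check (kappa : nat) (ss : seq segments) (n : nat) : bool :=
  let ps := arc_points kappa ss in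
  all (fun h0 =>
    let qs := [seq p <- ps | 5 %| dot h0 p.1] in
    all (fun h1 =>
      count (fun p => 5 %| kappa * (dot h0 p.1 %/ 5) + (dot h1 p.1 + dot h0 p.2)) qs
        <= n)
      [seq h1 <- digit_vectors | normal_digits h0 h1])
    digit_vectors.

(** Distinct base points x make the lists over them disjoint, so the length of [arc_points] counts
    points without repetition. *)
Definition size_check (kappa : nat) (ss : seq segments) (k : nat) : bool :=
  [&& uniq [seq s.1.1 | s <- ss],
      all (fun s => s.1.1 \in digit_vectors) ss &
      size (arc_points kappa ss) == k].

Lemma digit_vectors_uniq : uniq digit_vectors.
Proof. by []. Qed.

Lemma mem_digit_vectors (a b c : nat) :
  a < 5 -> b < 5 -> c < 5 -> [:: a; b; c] \in digit_vectors.
Proof.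
move=> a5 b5 c5; apply: (allpairs_f cons); rewrite ?mem_iota //.
by apply: (allpairs_f (fun b c => [:: b; c])); rewrite mem_iota.
Qed.

Lemma digit_vectorsP (u : seq nat) :
  u \in digit_vectors -> size u = 3 /\ forall i, nth 0 u i < 5.
Proof.
have /allP dvP : all (fun u => (size u == 3) && all (ltn^~ 5) u) digit_vectors by [].
move=> /dvP/andP[/eqP su /(all_nthP 0) u5]; split=> // i.
by have [/u5|?] := ltnP i (size u); rewrite // nth_default.
Qed.

Local Opaque digit_vectors.

Lemma arc_points_mem (kappa : nat) (ss : seq segments) (k : nat) p :
  size_check kappa ss k -> p \in arc_points kappa ss ->
  [/\ p.1 \in digit_vectors, p.2 \in digit_vectors & normal_digits p.1 p.2].
Proof.
move=> /and3P[_ /allP xs _] /flatten_mapP[[[x d] cs] /xs /= xin].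
case/mapP=> y; rewrite mem_filter => /andP[/andP[nxy _] yin] ->.
by split.
Qed.

Lemma arc_points_uniq (kappa : nat) (ss : seq segments) (k : nat) :
  size_check kappa ss k -> uniq (arc_points kappa ss).
Proof.
case/and3P=> + _ _; elim: ss => //= [[[x d] cs] ss IH] /= /andP[xss uss].
rewrite /arc_points /= cat_uniq IH // andbT; apply/andP; split.
  by rewrite map_inj_uniq ?filter_uniq ?digit_vectors_uniq // => y z [].
apply/hasPn => p /flatten_mapP[[[x' d'] cs'] s'in /mapP[y _ ->]].
apply/mapP => -[z _ [eqx _]]; move/negP: xss; apply.
by apply/mapP; exists (x', d', cs').
Qed.

(** * Coordinates over a chain ring of length 2 with residue field of order 5 *)

Section ChainRing.

Local Open Scope ring_scope.

Variables (R : finComNzRingType) (pi : R) (kappa : nat).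
Hypothesis pi_sqr0 : pi * pi = 0.
Hypothesis five_pi : 5%:R = kappa%:R * pi.
Hypothesis digits_exist :
  forall r : R, exists a b : nat, [/\ (a < 5)%N, (b < 5)%N & r = a%:R + b%:R * pi].
Hypothesis digits_inj : forall a b a' b' : nat,
  (a < 5)%N -> (b < 5)%N -> (a' < 5)%N -> (b' < 5)%N ->
  a%:R + b%:R * pi = a'%:R + b'%:R * pi -> a = a' /\ b = b'.

Definition inner (u v : 'rV[R]_3) : R := \sum_(i < 3) u 0 i * v 0 i.

Definition lift_digits (u v : seq nat) : 'rV[R]_3 :=
  \row_(i < 3) ((nth 0%N u i)%:R + (nth 0%N v i)%:R * pi).

(** The condition [pi * r = 0] says that r lies in the maximal ideal, so i is the position of the
    first unit entry. *)
Definition normal_vector (v : 'rV[R]_3) : Prop :=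
  exists i : 'I_3, v 0 i = 1 /\ forall j : 'I_3, (j < i)%N -> pi * v 0 j = 0.

Definition span1 (v : 'rV[R]_3) : {set 'rV[R]_3} := [set a *: v | a : R].

Lemma pi_neq0 : pi <> 0.
Proof.
move=> pi0; have [] // := digits_inj (erefl : 0 < 5)%N (erefl : 1 < 5)%N
  (erefl : 0 < 5)%N (erefl : 0 < 5)%N.
by rewrite pi0 !mulr0.
Qed.

Lemma natr_pi_mod5 (n : nat) : n%:R * pi = (n %% 5)%:R * pi.
Proof.
rewrite {1}(divn_eq n 5) natrD natrM mulrDl five_pi -!mulrA pi_sqr0.
by rewrite !mulr0 add0r.
Qed.

(** Writing s = 5 q + r and using 5 = kappa pi moves kappa q into the pi-digit. That digit matters
    only modulo 5, because 5 pi = kappa pi^2 = 0. *)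
Lemma digits_eq0 (s t : nat) :
  s%:R + t%:R * pi = 0 -> (5 %| s)%N && (5 %| kappa * (s %/ 5) + t)%N.
Proof.
have -> : s%:R + t%:R * pi = (s %% 5)%:R + (kappa * (s %/ 5) + t)%:R * pi.
  rewrite {1}(divn_eq s 5) natrD natrM five_pi natrD natrM; ring.
rewrite natr_pi_mod5 => e0.
have [] := @digits_inj (s %% 5) ((kappa * (s %/ 5) + t) %% 5) 0 0.
- by rewrite ltn_mod.
- by rewrite ltn_mod.
- by [].
- by [].
- by rewrite e0 mul0r addr0.
by rewrite /dvdn => -> ->.
Qed.

Lemma inner_lift_digits (h0 h1 x y : seq nat) :
  inner (lift_digits h0 h1) (lift_digits x y) =
  (dot h0 x)%:R + (dot h1 x + dot h0 y)%:R * pi.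
Proof.
(* The vanishing pi^2 term is kept so that the expansion becomes a polynomial identity for
   [ring]. *)
transitivity ((dot h0 x)%:R + (dot h1 x + dot h0 y)%:R * pi
    + (dot h1 y)%:R * (pi * pi)); last by rewrite pi_sqr0 mulr0 addr0.
rewrite /inner !big_ord_recl big_ord0 !mxE /= /bump /= /dot !natrD !natrM.
by ring.
Qed.

Lemma inner_lift_eq0 (h0 h1 x y : seq nat) :
  inner (lift_digits h0 h1) (lift_digits x y) = 0 ->
  (5 %| dot h0 x)%N &&
  (5 %| kappa * (dot h0 x %/ 5) + (dot h1 x + dot h0 y))%N.
Proof. by rewrite inner_lift_digits => /digits_eq0. Qed.

Lemma innerZl (c : R) (u v : 'rV[R]_3) : inner (c *: u) v = c * inner u v.
Proof. by rewrite mulr_sumr; apply: eq_bigr => i _; rewrite mxE mulrA. Qed.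

Lemma lift_digits_inj (u v u' v' : seq nat) :
  u \in digit_vectors -> v \in digit_vectors ->
  u' \in digit_vectors -> v' \in digit_vectors ->
  lift_digits u v = lift_digits u' v' -> (u, v) = (u', v').
Proof.
move=> /digit_vectorsP[su du] /digit_vectorsP[sv dv].
move=> /digit_vectorsP[su' du'] /digit_vectorsP[sv' dv'] /rowP eqL.
have eqn (i : nat) : (i < 3)%N ->
    nth 0%N u i = nth 0%N u' i /\ nth 0%N v i = nth 0%N v' i.
  by move=> i3; have := eqL (Ordinal i3); rewrite !mxE /=; apply: digits_inj.
congr pair; apply: (@eq_from_nth _ 0%N); rewrite ?su ?sv ?su' ?sv' // => i /eqn.
  by case.
by case.
Qed.

Lemma lift_digits_normal (u v : seq nat) :
  size u = 3 -> normal_digits u v -> normal_vector (lift_digits u v).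
Proof.
move=> su /andP[/eqP u1 /eqP v0].
have i3 : (pivot u < 3)%N.
  by rewrite ltnNge; apply/negP => i3; rewrite nth_default ?su in u1.
exists (Ordinal i3); rewrite mxE /= u1 v0 mul0r addr0; split=> // j /= ji.
have /negbT := before_find 0%N ji; rewrite negbK => /eqP uj0.
by rewrite mxE uj0 add0r mulrCA pi_sqr0 mulr0.
Qed.

(** Different pivots would give pi = 0: if i < j then pi a = pi v_i = 0, and if j < i then pi u_j =
    0, while 1 = v_j = a u_j in both cases. With equal pivots a = 1. *)
Lemma normal_scale_inj (a : R) (u v : 'rV[R]_3) :
  normal_vector u -> normal_vector v -> v = a *: u -> v = u.
Proof.
move=> [i [ui piu]] [j [vj piv]] eqv.
have vE k : v 0 k = a * u 0 k by rewrite eqv mxE.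
have vi : v 0 i = a by rewrite vE ui mulr1.
have [ij|ji|/val_inj eqij] := ltngtP i j.
- case: pi_neq0; rewrite -[pi]mulr1 -vj vE mulrA.
  by rewrite -[a]vi piv // mul0r.
- case: pi_neq0; rewrite -[pi]mulr1 -vj vE mulrCA.
  by rewrite piu // mulr0.
- by rewrite eqv -vi eqij vj scale1r.
Qed.

Lemma normal_scaler_inj (v : 'rV[R]_3) :
  normal_vector v -> injective (fun a : R => a *: v).
Proof.
by move=> [i [vi _]] a b /rowP/(_ i); rewrite !mxE vi !mulr1.
Qed.

Lemma span1_normal_inj (u v : 'rV[R]_3) :
  normal_vector u -> normal_vector v -> span1 u = span1 v -> u = v.
Proof.
move=> nu nv eqs.
have : u \in span1 u by apply/imsetP; exists 1; rewrite ?scale1r.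
by rewrite eqs => /imsetP[a _]; apply: normal_scale_inj.
Qed.

Lemma unit_of_pi_neq0 (r : R) : pi * r <> 0 -> exists c, c * r = 1.
Proof.
have [a [b [a5 _ ->]]] := digits_exist r => pir.
have a0 : (0 < a)%N.
  by case: a a5 pir => // _ []; rewrite add0r mulrCA pi_sqr0 mulr0.
have [c [m ac]] : exists c m, (c * a = m * 5 + 1)%N.
  case: a a0 a5 {pir} => [|[|[|[|[|a]]]]] // _ _.
  - by exists 1%N, 0%N.
  - by exists 3%N, 1%N.
  - by exists 2%N, 1%N.
  - by exists 4%N, 3%N.
(* Since c a = 5 m + 1 and 5 = kappa pi, multiplying r by c gives 1 + t pi with t = m kappa + c b,
   whose inverse is 1 - t pi. *)
exists ((1 - (m * kappa + c * b)%:R * pi) * c%:R).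
have -> : (1 - (m * kappa + c * b)%:R * pi) * c%:R * (a%:R + b%:R * pi) =
   (1 - (m * kappa + c * b)%:R * pi) * ((c * a)%:R + (c * b)%:R * pi).
  by rewrite !natrM; ring.
have -> : (c * a)%:R = m%:R * (kappa%:R * pi) + 1 :> R.
  by rewrite ac natrD natrM five_pi.
have -> : (1 - (m * kappa + c * b)%:R * pi) *
   (m%:R * (kappa%:R * pi) + 1 + (c * b)%:R * pi) =
   1 - (m * kappa + c * b)%:R ^+ 2 * (pi * pi).
  by rewrite !natrD !natrM; ring.
by rewrite pi_sqr0 mulr0 subr0.
Qed.

(** The last two clauses turn the conditions before and at the pivot of a normal vector into
    conditions on digits. *)
Lemma adapted_digits (r : R) :
  exists a b : nat, [/\ (a < 5)%N, (b < 5)%N, r = a%:R + b%:R * pi,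
    (pi * r = 0 -> a = 0%N) & (r = 1 -> a = 1%N /\ b = 0%N)].
Proof.
have [a [b [a5 b5 rE]]] := digits_exist r; exists a, b; split=> // [pir|r1].
  have api : a%:R * pi = pi * r.
    by rewrite rE mulrDr [pi * (_ * _)]mulrCA pi_sqr0 mulr0 addr0 mulrC.
  have [] // := digits_inj (erefl : 0 < 5)%N a5 (erefl : 0 < 5)%N (erefl : 0 < 5)%N.
  by rewrite api pir mul0r.
by apply: digits_inj; rewrite // -rE r1 mul0r addr0.
Qed.

Lemma normalize (h : 'rV[R]_3) : pi *: h <> 0 ->
  exists (c : R) (h0 h1 : seq nat), [/\ h0 \in digit_vectors,
    h1 \in digit_vectors, normal_digits h0 h1 & c *: h = lift_digits h0 h1].
Proof.
move=> pih.
have [i0 pihi0] : exists i, pi * h 0 i != 0.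
  apply/existsP; rewrite -negb_forall; apply/negP => /forallP h0.
  by apply: pih; apply/rowP => i; rewrite !mxE; apply/eqP.
(* The first coordinate not killed by pi is a unit. Dividing by it makes it 1 and leaves the earlier
   ones killed by pi. *)
case: (@arg_minnP _ i0 (fun i => pi * h 0 i != 0) val pihi0) => i pihi imin.
have [c chi] := unit_of_pi_neq0 (elimN eqP pihi).
have chj (j : 'I_3) : (j < i)%N -> pi * (c * h 0 j) = 0.
  move=> ji; rewrite mulrCA; have [->|/imin] := eqVneq (pi * h 0 j) 0.
    by rewrite mulr0.
  by rewrite /= leqNgt ji.
have [a0 [b0 [a05 b05 e0 z0 n0]]] := adapted_digits (c * h 0 (Ordinal (erefl : 0 < 3)%N)).
have [a1 [b1 [a15 b15 e1 z1 n1]]] := adapted_digits (c * h 0 (Ordinal (erefl : 1 < 3)%N)).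
have [a2 [b2 [a25 b25 e2 z2 n2]]] := adapted_digits (c * h 0 (Ordinal (erefl : 2 < 3)%N)).
exists c, [:: a0; a1; a2], [:: b0; b1; b2]; split; rewrite ?mem_digit_vectors //.
  have iE (m : nat) (m3 : (m < 3)%N) : val i = m -> c * h 0 (Ordinal m3) = 1.
    by move=> im; rewrite -chi; congr (c * h 0 _); apply: val_inj.
  have jE (m : nat) (m3 : (m < 3)%N) : (m < i)%N -> pi * (c * h 0 (Ordinal m3)) = 0.
    exact: (chj (Ordinal m3)).
  case: (i) iE jE => [[|[|[|//]]] ?] /= iE jE.
  - by have [-> ->] := n0 (iE _ _ erefl).
  - by rewrite z0 ?jE //; have [-> ->] := n1 (iE _ _ erefl).
  - by rewrite z0 ?z1 ?jE //; have [-> ->] := n2 (iE _ _ erefl).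
apply/rowP => -[[|[|[|//]]] m3]; rewrite !mxE /=.
- by rewrite -e0; congr (c * h 0 _); apply: val_inj.
- by rewrite -e1; congr (c * h 0 _); apply: val_inj.
- by rewrite -e2; congr (c * h 0 _); apply: val_inj.
Qed.

(* If pi kills the cross product of x and y, then pi (x_i y - y_i x) = 0 for all i,
   so injectivity gives pi x = 0 and finally pi = 0. *)
Lemma line_normal (x y : 'rV[R]_3) :
  injective (fun ab : R * R => ab.1 *: x + ab.2 *: y) ->
  exists h, pi *: h <> 0 /\ forall a b, inner h (a *: x + b *: y) = 0.
Proof.
move=> inj; pose minor i j := x 0 i * y 0 j - x 0 j * y 0 i.
pose o i : 'I_3 := inord i.
(* The cross product of x and y, orthogonal to both. *)
exists (\row_i nth 0 [:: minor (o 1) (o 2); minor (o 2) (o 0); minor (o 0) (o 1)]%N i).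
split=> [/rowP pih | a b]; last first.
  rewrite /inner !big_ord_recl big_ord0 !mxE /= /minor.
  have -> : o 0%N = ord0 by apply: val_inj; rewrite /= inordK.
  have -> : o 1%N = lift ord0 ord0 by apply: val_inj; rewrite /= inordK.
  have -> : o 2%N = lift ord0 (lift ord0 ord0) by apply: val_inj; rewrite /= inordK.
  by ring.
have pi_minor i j : pi * minor i j = 0.
  have m01 : pi * minor (o 0) (o 1) = 0 by have := pih (o 2); rewrite !mxE /= inordK.
  have m12 : pi * minor (o 1) (o 2) = 0 by have := pih (o 0); rewrite !mxE /= inordK.
  have m20 : pi * minor (o 2) (o 0) = 0 by have := pih (o 1); rewrite !mxE /= inordK.
  have mC i' j' : pi * minor i' j' = 0 -> pi * minor j' i' = 0.
    by move=> m0; rewrite /minor -opprB mulrN -/(minor i' j') m0 oppr0.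
  have mI i' : pi * minor i' i' = 0 by rewrite /minor subrr mulr0.
  rewrite -[i]inord_val -[j]inord_val -/(o i) -/(o j).
  by case: i => [[|[|[|//]]] ?]; case: j => [[|[|[|//]]] ?] /=; auto.
have pix i : pi * x 0 i = 0 /\ pi * y 0 i = 0.
  have : (- (pi * y 0 i), pi * x 0 i) = (0, 0).
    apply: inj; apply/rowP => j; rewrite !mxE /= !mul0r addr0 -(pi_minor i j) /minor.
    by ring.
  by case=> /eqP; rewrite oppr_eq0 => /eqP -> ->.
apply: pi_neq0; suff [] : (pi, 0) = (0, 0) :> R * R by [].
apply: inj; apply/rowP => j; rewrite !mxE /= !mul0r !addr0.
by case: (pix j).
Qed.

(** Every line lies in the kernel of some normalized h, which is among the equations tested by
    [line_check]. The number of arc points solving that equation therefore bounds the number on the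
    line. *)
Lemma arc_of_checks (ss : seq segments) (k n : nat) :
  size_check kappa ss k -> line_check kappa ss n -> proj_arc_exists R k n.
Proof.
move=> sck lck; set ps := arc_points kappa ss.
pose f p := span1 (lift_digits p.1 p.2).
have psP p : p \in ps -> normal_vector (lift_digits p.1 p.2).
  by move=> /(arc_points_mem sck)[/digit_vectorsP[? _] _]; apply: lift_digits_normal.
exists [set:: map f ps]; split.
- move=> P; rewrite inE => /mapP[p /psP np ->].
  by exists (lift_digits p.1 p.2); split=> //; apply: normal_scaler_inj.
- rewrite cardsE; have /card_uniqP -> : uniq (map f ps).
    rewrite map_inj_in_uniq ?(arc_points_uniq sck) // => -[u v] [u' v'] pin qin.
    move=> /(span1_normal_inj (psP _ pin) (psP _ qin)) /=.
    have [? ? _] := arc_points_mem sck pin; have [? ? _] := arc_points_mem sck qin.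
    exact: lift_digits_inj.
  by rewrite size_map; case/and3P: sck => _ _ /eqP.
move=> L [x [y [-> /line_normal[h [pih hL]]]]].
have [c [h0 [h1 [h0in h1in nh ch]]]] := normalize pih.
have := allP lck h0 h0in => /allP/(_ h1); rewrite mem_filter nh h1in => /(_ isT).
rewrite count_filter; apply: leq_trans.
rewrite -size_filter -(size_map f); apply: leq_trans (card_size _).
apply/subset_leq_card/subsetP => P; rewrite !inE => /andP[/mapP[p pin ->] /subsetP sub].
apply/map_f; rewrite mem_filter pin andbT.
(* A point contained in the line has its normal representative there, so this representative
   satisfies the equation of h. *)
have /sub/imsetP[ab _ pE] : lift_digits p.1 p.2 \in f p.
  by apply/imsetP; exists 1; rewrite ?scale1r.
have := @inner_lift_eq0 h0 h1 p.1 p.2.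
by rewrite -ch innerZl pE hL mulr0 => /(_ erefl) /=; rewrite andbC.
Qed.

End ChainRing.

(** * The search data for the three arcs *)

(** Each listed residue contributes one segment of 5 points, here 71 segments in all. Nothing lies
    over an omitted x. *)
Definition arc355 : seq segments := [::
  ([:: 0; 0; 1], [:: 1; 0; 0], [:: 0; 1; 2]);
  ([:: 0; 1; 0], [:: 1; 0; 3], [:: 0]);
  ([:: 0; 1; 1], [:: 1; 3; 2], [:: 0; 1]);
  ([:: 0; 1; 2], [:: 1; 2; 4], [:: 0; 1]);
  ([:: 0; 1; 3], [:: 0; 1; 3], [:: 0; 1]);
  ([:: 0; 1; 4], [:: 1; 2; 2], [:: 0; 1; 2]);
  ([:: 1; 0; 0], [:: 0; 1; 3], [:: 0; 1]);
  ([:: 1; 0; 1], [:: 1; 2; 4], [:: 0; 1]);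
  ([:: 1; 0; 2], [:: 1; 3; 2], [:: 0; 1]);
  ([:: 1; 0; 3], [:: 1; 0; 3], [:: 0; 1; 2]);
  ([:: 1; 0; 4], [:: 1; 4; 1], [:: 0; 1; 2]);
  ([:: 1; 1; 0], [:: 0; 0; 1], [:: 0; 1; 2]);
  ([:: 1; 1; 1], [:: 1; 0; 4], [:: 0; 1; 2]);
  ([:: 1; 1; 2], [:: 1; 0; 2], [:: 0; 1; 2]);
  ([:: 1; 1; 4], [:: 1; 0; 1], [:: 0; 1; 2]);
  ([:: 1; 2; 0], [:: 1; 2; 4], [:: 0; 2]);
  ([:: 1; 2; 1], [:: 0; 1; 3], [:: 0; 2]);
  ([:: 1; 2; 2], [:: 1; 3; 4], [:: 0; 1; 2]);
  ([:: 1; 2; 3], [:: 1; 0; 3], [:: 1; 3; 4]);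
  ([:: 1; 2; 4], [:: 1; 3; 2], [:: 0; 2]);
  ([:: 1; 3; 0], [:: 1; 3; 2], [:: 2; 4]);
  ([:: 1; 3; 1], [:: 0; 1; 2], [:: 0; 1; 2]);
  ([:: 1; 3; 2], [:: 1; 2; 4], [:: 2; 4]);
  ([:: 1; 3; 3], [:: 1; 0; 3], [:: 0; 2; 3]);
  ([:: 1; 3; 4], [:: 0; 1; 3], [:: 2; 4]);
  ([:: 1; 4; 0], [:: 1; 1; 0], [:: 0; 1; 2]);
  ([:: 1; 4; 1], [:: 1; 3; 2], [:: 1; 3]);
  ([:: 1; 4; 2], [:: 0; 1; 3], [:: 1; 3]);
  ([:: 1; 4; 3], [:: 1; 0; 3], [:: 4]);
  ([:: 1; 4; 4], [:: 1; 2; 4], [:: 1; 3])].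

Definition arc375 : seq segments := [::
  ([:: 0; 0; 1], [:: 1; 4; 0], [:: 0; 1]);
  ([:: 0; 1; 0], [:: 1; 0; 1], [:: 0; 1]);
  ([:: 0; 1; 1], [:: 1; 4; 1], [:: 0; 1; 2; 3]);
  ([:: 0; 1; 2], [:: 1; 1; 2], [:: 0; 1]);
  ([:: 0; 1; 3], [:: 1; 2; 1], [:: 0; 1; 2]);
  ([:: 0; 1; 4], [:: 1; 2; 2], [:: 0; 1; 2]);
  ([:: 1; 0; 0], [:: 0; 0; 1], [:: 0; 1; 2]);
  ([:: 1; 0; 1], [:: 1; 2; 4], [:: 0; 1; 2]);
  ([:: 1; 0; 2], [:: 1; 1; 2], [:: 0; 1]);
  ([:: 1; 0; 3], [:: 0; 1; 0], [:: 0; 1; 2; 3]);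
  ([:: 1; 0; 4], [:: 1; 0; 1], [:: 0]);
  ([:: 1; 1; 0], [:: 1; 4; 0], [:: 0; 1]);
  ([:: 1; 1; 1], [:: 1; 4; 0], [:: 0; 3]);
  ([:: 1; 1; 2], [:: 1; 4; 0], [:: 2; 3]);
  ([:: 1; 1; 3], [:: 1; 4; 0], [:: 1; 2]);
  ([:: 1; 2; 1], [:: 1; 1; 2], [:: 0; 2]);
  ([:: 1; 2; 2], [:: 1; 2; 0], [:: 0; 1; 2]);
  ([:: 1; 2; 3], [:: 1; 2; 0], [:: 0; 1; 2]);
  ([:: 1; 2; 4], [:: 1; 0; 1], [:: 0; 1]);
  ([:: 1; 3; 0], [:: 0; 0; 1], [:: 0; 1; 2]);
  ([:: 1; 3; 1], [:: 1; 1; 1], [:: 0; 1; 2; 3]);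
  ([:: 1; 3; 2], [:: 1; 2; 4], [:: 0; 1; 2]);
  ([:: 1; 3; 3], [:: 1; 1; 2], [:: 2; 4]);
  ([:: 1; 3; 4], [:: 1; 0; 1], [:: 1; 4]);
  ([:: 1; 4; 0], [:: 1; 1; 2], [:: 1; 3]);
  ([:: 1; 4; 1], [:: 1; 2; 1], [:: 0; 1; 2]);
  ([:: 1; 4; 2], [:: 1; 3; 1], [:: 0; 1; 2; 3]);
  ([:: 1; 4; 3], [:: 1; 2; 2], [:: 0; 1; 2]);
  ([:: 1; 4; 4], [:: 1; 0; 1], [:: 3; 4])].

Definition arc395 : seq segments := [::
  ([:: 0; 0; 1], [:: 1; 1; 0], [:: 0]);
  ([:: 0; 1; 0], [:: 1; 0; 1], [:: 0; 1]);
  ([:: 0; 1; 1], [:: 1; 0; 0], [:: 0; 1; 2]);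
  ([:: 0; 1; 2], [:: 1; 3; 1], [:: 0; 1]);
  ([:: 0; 1; 3], [:: 1; 2; 1], [:: 0; 1]);
  ([:: 0; 1; 4], [:: 1; 0; 0], [:: 0; 1; 2]);
  ([:: 1; 0; 0], [:: 0; 1; 2], [:: 0; 1; 2]);
  ([:: 1; 0; 1], [:: 1; 4; 4], [:: 0; 1; 2; 3]);
  ([:: 1; 0; 2], [:: 1; 0; 2], [:: 0; 1; 2; 3]);
  ([:: 1; 0; 3], [:: 1; 0; 3], [:: 0; 1; 2]);
  ([:: 1; 0; 4], [:: 1; 2; 1], [:: 0; 1]);
  ([:: 1; 1; 0], [:: 1; 4; 2], [:: 0; 1; 2; 3]);
  ([:: 1; 1; 1], [:: 1; 3; 1], [:: 0; 1; 3]);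
  ([:: 1; 1; 2], [:: 1; 2; 1], [:: 0; 3]);
  ([:: 1; 1; 3], [:: 1; 0; 3], [:: 0; 1; 2]);
  ([:: 1; 1; 4], [:: 1; 0; 1], [:: 0; 1; 3]);
  ([:: 1; 2; 0], [:: 1; 2; 1], [:: 2; 3]);
  ([:: 1; 2; 1], [:: 1; 2; 0], [:: 0; 1; 2]);
  ([:: 1; 2; 2], [:: 1; 2; 0], [:: 0; 1; 2]);
  ([:: 1; 2; 3], [:: 1; 3; 1], [:: 3; 4]);
  ([:: 1; 2; 4], [:: 1; 0; 1], [:: 3; 4]);
  ([:: 1; 3; 0], [:: 1; 3; 1], [:: 1; 2; 4]);
  ([:: 1; 3; 1], [:: 0; 1; 2], [:: 0; 1; 2]);
  ([:: 1; 3; 2], [:: 1; 2; 4], [:: 0; 1; 2; 3]);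
  ([:: 1; 3; 3], [:: 1; 2; 1], [:: 1; 2]);
  ([:: 1; 3; 4], [:: 1; 0; 1], [:: 1; 2; 4]);
  ([:: 1; 4; 0], [:: 1; 1; 0], [:: 0; 1; 2]);
  ([:: 1; 4; 1], [:: 1; 1; 0], [:: 0; 1]);
  ([:: 1; 4; 2], [:: 1; 3; 1], [:: 2]);
  ([:: 1; 4; 3], [:: 1; 1; 0], [:: 2]);
  ([:: 1; 4; 4], [:: 1; 0; 1], [:: 2])].

(** * The two rings as instances *)

Lemma arc_Z25 (ss : seq segments) (k n : nat) :
  size_check 1 ss k -> line_check 1 ss n -> proj_arc_exists 'Z_25 k n.
Proof.
apply: (@arc_of_checks 'Z_25 5%:R%R 1) => [||r|a b a' b' a5 b5 a'5 b'5].
- exact: val_inj.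
- exact: val_inj.
- exists (r %% 5), (r %/ 5); split; first by rewrite ltn_mod.
    by rewrite ltn_divLR // (ltn_ord r).
  by rewrite -natrM -natrD addnC -divn_eq natr_Zp.
(* Both sides have the form a + 5 b < 25, so reduction modulo 25 does not change them. *)
- rewrite -!natrM -!natrD => /(congr1 val); rewrite /= !val_Zp_nat //.
  by rewrite !modn_small; lia.
Qed.

Lemma natr_S5 (m : nat) : (m%:R = (m%:R, 0) :> S5)%R.
Proof.
elim: m => // m IH; rewrite -natr1 IH -[in RHS]natr1.
by congr pair; exact: addr0.
Qed.

Lemma digits_S5 (a b : nat) :
  (a%:R + b%:R * S5_X = (a%:R, b%:R) :> S5)%R.
Proof.
rewrite !natr_S5; apply/eqP; rewrite xpair_eqE; apply/andP.
by rewrite /= mulr0 addr0 add0r mulr1 mul0r addr0.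
Qed.

Lemma arc_S5 (ss : seq segments) (k n : nat) :
  size_check 0 ss k -> line_check 0 ss n -> proj_arc_exists S5 k n.
Proof.
apply: (@arc_of_checks S5 S5_X 0) => [||[x y]|a b a' b' a5 b5 a'5 b'5].
- by apply/eqP.
- by rewrite natr_S5; apply/eqP.
- exists x, y; split; [exact: (ltn_ord x) | exact: (ltn_ord y) |].
  by rewrite digits_S5 !natr_Zp.
- rewrite !digits_S5 => -[/(congr1 val) + /(congr1 val)].
  by rewrite /= !val_Fp_nat // !modn_small.
Qed.

Theorem theorem3p9 :
  (proj_arc_exists 'Z_25 355 15 /\
   proj_arc_exists 'Z_25 375 16 /\
   proj_arc_exists 'Z_25 395 17) /\
  (proj_arc_exists S5 355 15 /\
   proj_arc_exists S5 375 16 /\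
   proj_arc_exists S5 395 17).
Proof.
do !split.
- by apply: (@arc_Z25 arc355); vm_compute.
- by apply: (@arc_Z25 arc375); vm_compute.
- by apply: (@arc_Z25 arc395); vm_compute.
- by apply: (@arc_S5 arc355); vm_compute.
- by apply: (@arc_S5 arc375); vm_compute.
- by apply: (@arc_S5 arc395); vm_compute.
Qed.
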